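(* As formal power series in $q$ (equivalently, for all complex $q$ with $|q|<1$), $$\sum_{n,r\ge 0} \frac{q^{n^2+3r^2+4nr}\,(-q;-q)_{2n+2r}}{(q^2;q^2)_{2n+2r}\,(q^2;q^2)_r\,(q^2;q^2)_n} = \frac{(q^6,q^8,q^{14};q^{14})_\infty\,(q^2;q^4)_\infty}{(q;q)_\infty}.$$
   Context: Notation: $(a;p)_m=\prod_{j=0}^{m-1}(1-ap^j)$ for integers $m\ge 0$, $(a;p)_\infty=\prod_{j=0}^{\infty}(1-ap^j)$, and $(a_1,\dots,a_s;p)_\infty=(a_1;p)_\infty\cdots(a_s;p)_\infty$. Here the base $p$ may be $q$, a power of $q$, or $-q$; in particular $(-q;-q)_{m}=\prod_{j=1}^{m}(1-(-q)^j)$. *)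

(* Defs.v *)
From HB Require Import structures.
From mathcomp Require Import all_boot all_order all_algebra.
From mathcomp Require Import finmap.
From mathcomp Require Import boolp classical_sets.

Set Implicit Arguments.
Unset Strict Implicit.
Unset Printing Implicit Defensive.

Import GRing.Theory.
Local Open Scope ring_scope.

(* Formal power series in one variable over R; f k is the coefficient of q^k. *)
Record fps (R : Type) := Fps { fps_coef :> nat -> R }.

HB.instance Definition _ (R : Type) := gen_eqMixin (fps R).
HB.instance Definition _ (R : Type) := gen_choiceMixin (fps R).

Lemma fpsP (R : Type) (f g : fps R) : (forall k, f k = g k) -> f = g.
Proof. by case: f g => f [g] /= fg; congr Fps; apply/funext. Qed.

Section FpsRing.
Variable R : comNzRingType.
Implicit Types f g h : fps R.

Definition fps_add f g : fps R := Fps (fun k => f k + g k).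
Definition fps_opp f : fps R := Fps (fun k => - f k).
Definition fps_zero : fps R := Fps (fun=> 0).

Fact fps_addA : associative fps_add.
Proof. by move=> f g h; apply: fpsP => k /=; rewrite addrA. Qed.
Fact fps_addC : commutative fps_add.
Proof. by move=> f g; apply: fpsP => k /=; rewrite addrC. Qed.
Fact fps_add0 : left_id fps_zero fps_add.
Proof. by move=> f; apply: fpsP => k /=; rewrite add0r. Qed.
Fact fps_addN : left_inverse fps_zero fps_opp fps_add.
Proof. by move=> f; apply: fpsP => k /=; rewrite addNr. Qed.

HB.instance Definition _ :=
  GRing.isZmodule.Build (fps R) fps_addA fps_addC fps_add0 fps_addN.

Definition fps_mul f g : fps R :=
  Fps (fun k => \sum_(i < k.+1) f i * g (k - i)%N).
Definition fps_one : fps R := Fps (fun k => (k == 0%N)%:R).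

Definition fps_trunc n f : {poly R} := \poly_(i < n.+1) f i.

Lemma coef_fps_trunc n f k : (k <= n)%N -> (fps_trunc n f)`_k = f k.
Proof. by move=> kn; rewrite coef_poly ltnS kn. Qed.

Lemma fps_mul_trunc n f g k : (k <= n)%N ->
  fps_mul f g k = (fps_trunc n f * fps_trunc n g)`_k.
Proof.
move=> kn; rewrite coefM; apply: eq_bigr => i _; congr (_ * _).
  by rewrite coef_fps_trunc// (leq_trans _ kn)// -ltnS.
by rewrite coef_fps_trunc// (leq_trans (leq_subr _ _) kn).
Qed.

Fact fps_mulC : commutative fps_mul.
Proof. by move=> f g; apply: fpsP => k; rewrite !(@fps_mul_trunc k)// mulrC. Qed.

Fact fps_mulA : associative fps_mul.
Proof.
move=> f g h; apply: fpsP => k.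
transitivity ((fps_trunc k f * (fps_trunc k g * fps_trunc k h))`_k).
  rewrite coefM; apply: eq_bigr => i _; rewrite coef_fps_trunc ?leq_ord//.
  by rewrite (@fps_mul_trunc k)// leq_subr.
rewrite mulrA coefM; apply: eq_bigr => i _; rewrite coef_fps_trunc ?leq_subr//.
by rewrite (@fps_mul_trunc k)// leq_ord.
Qed.

Fact fps_mul1 : left_id fps_one fps_mul.
Proof.
move=> f; apply: fpsP => k /=; rewrite big_ord_recl mul1r subn0 big1 ?addr0//.
by move=> i _; rewrite mul0r.
Qed.

Fact fps_mulDl : left_distributive fps_mul fps_add.
Proof.
move=> f g h; apply: fpsP => k /=; rewrite -big_split/=.
by apply: eq_bigr => i _; rewrite mulrDl.
Qed.

Fact fps_one_neq0 : fps_one != 0.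
Proof. by apply/eqP => /(congr1 (fun f => f 0%N))/eqP; rewrite /= oner_eq0. Qed.

HB.instance Definition _ := GRing.Zmodule_isComNzRing.Build (fps R)
  fps_mulA fps_mulC fps_mul1 fps_mulDl fps_one_neq0.

Definition fps_unit : {pred fps R} := fun f => `[< exists g, g * f = 1 >].
Definition fps_inv f : fps R := xget f [set g | g * f = 1].

Fact fps_mulV : {in fps_unit, left_inverse 1 fps_inv *%R}.
Proof.
by move=> f /asboolP f1; exact: (@xgetPex _ f [set g | g * f = 1] f1).
Qed.
Fact fps_unitPl : forall f g, g * f = 1 -> fps_unit f.
Proof. by move=> f g gf; apply/asboolP; exists g. Qed.
Fact fps_invr_out : {in [predC fps_unit], fps_inv =1 id}.
Proof.
move=> f /negP nf; rewrite /fps_inv; case: xgetP => // g _ /= gf.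
by case: nf; apply: fps_unitPl gf.
Qed.

HB.instance Definition _ := GRing.ComNzRing_hasMulInverse.Build (fps R)
  fps_mulV fps_unitPl fps_invr_out.

Definition fpsX : fps R := Fps (fun k => (k == 1%N)%:R).

Lemma fps_coefD f g k : (f + g) k = f k + g k. Proof. by []. Qed.
Lemma fps_coefN f k : (- f) k = - f k. Proof. by []. Qed.
Lemma fps_coef0 k : (0 : fps R) k = 0. Proof. by []. Qed.
Lemma fps_coef1 k : (1 : fps R) k = (k == 0%N)%:R. Proof. by []. Qed.
Lemma fps_coefM f g k : (f * g) k = \sum_(i < k.+1) f i * g (k - i)%N.
Proof. by []. Qed.
Lemma fps_coef_sum (I : Type) (s : seq I) (P : pred I) (F : I -> fps R) k :
  (\sum_(i <- s | P i) F i) k = \sum_(i <- s | P i) F i k.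
Proof. exact: (big_morph (fun f : fps R => f k) (fun f g => erefl)). Qed.

Lemma fps_coefMX0 f g m k : f 0%N = 0 -> (k < m)%N -> (g * f ^+ m) k = 0.
Proof.
move=> f0; elim: m g k => // m IHm g k; rewrite ltnS => km.
rewrite exprSr mulrA fps_coefM big1// => i _.
have [ik|] := ltnP i k; first by rewrite IHm ?mul0r// (leq_trans ik).
by rewrite -subn_eq0 => /eqP ->; rewrite f0 mulr0.
Qed.

Lemma fps_unit1 f : f 0%N = 1 -> f \is a GRing.unit.
Proof.
move=> f0; set h := 1 - f.
have h0 : h 0%N = 0 by rewrite fps_coefD fps_coefN f0 subrr.
have hX m k : (k < m)%N -> (h ^+ m) k = 0.
  by move=> km; rewrite -[h ^+ m]mul1r fps_coefMX0.
pose S n := \sum_(m < n) h ^+ m.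
have SE j k : (j <= k)%N -> S k.+1 j = S j.+1 j.
  move=> jk; rewrite /S -!(big_mkord xpredT (fun m => h ^+ m)).
  rewrite (big_cat_nat _ (n := j.+1))// fps_coefD [X in _ + X](_ : _ = 0).
    by rewrite addr0.
  by rewrite fps_coef_sum big_nat big1// => m /andP[jm _]; exact: hX.
suff gf : Fps (fun k => S k.+1 k) * f = 1.
  by apply/unitrPr; exists (Fps (fun k => S k.+1 k)); rewrite mulrC.
apply: fpsP => k; transitivity ((S k.+1 * f) k).
  by rewrite !fps_coefM; apply: eq_bigr => i _; rewrite /= (SE i k)// -ltnS.
have -> : f = 1 - h by rewrite /h opprB addrC subrK.
rewrite mulrC -opprB mulNr -subrX1 opprB fps_coefD fps_coefN hX//.
by rewrite subr0.
Qed.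

(* Convergence in the q-adic topology: each coefficient is eventually
   constant. *)
Definition fps_cvg (u : nat -> fps R) (l : fps R) : Prop :=
  forall k, exists N : nat, forall n, (N <= n)%N -> u n k = l k.

(* 0 when u diverges; qpoch_inf_cvg rules this out for the products (a; p)_oo
   whose base p has no constant term. *)
Definition fps_lim (u : nat -> fps R) : fps R := xget 0 [set l | fps_cvg u l].

(* Unordered summation: S is the q-adic limit of the sums over finite subsets
   of I. *)
Definition fps_has_sum (I : choiceType) (F : I -> fps R) (S : fps R) : Prop :=
  forall k, exists J0 : {fset I}, forall J : {fset I},
    (J0 `<=` J)%fset -> (\sum_(i <- J) F i) k = S k.

(* (a; p)_m *)
Definition qpoch (a p : fps R) (m : nat) : fps R :=
  \prod_(0 <= j < m) (1 - a * p ^+ j).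

(* (a; p)_oo *)
Definition qpoch_inf (a p : fps R) : fps R := fps_lim (qpoch a p).

(* (a_1, ..., a_s; p)_oo *)
Definition qpochs_inf (s : seq (fps R)) (p : fps R) : fps R :=
  \prod_(a <- s) qpoch_inf a p.

Lemma fps_cvg_unique u l1 l2 : fps_cvg u l1 -> fps_cvg u l2 -> l1 = l2.
Proof.
move=> u1 u2; apply: fpsP => k.
have [[N1 h1] [N2 h2]] := (u1 k, u2 k).
by rewrite -(h1 (maxn N1 N2)) ?leq_maxl// h2 ?leq_maxr.
Qed.

Lemma fps_limP u l : fps_cvg u l -> fps_lim u = l.
Proof.
move=> ul; apply: (@fps_cvg_unique u) => //.
by apply: (@xgetPex _ 0 [set l | fps_cvg u l]); exists l.
Qed.

Lemma qpochS (a p : fps R) m :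
  qpoch a p m.+1 = qpoch a p m * (1 - a * p ^+ m).
Proof. by rewrite /qpoch big_nat_recr. Qed.

Lemma qpoch_coef0 (a p : fps R) m : a 0%N = 0 -> qpoch a p m 0%N = 1.
Proof.
move=> a0; elim: m => [|m IHm]; first by rewrite /qpoch big_geq.
rewrite qpochS fps_coefM big_ord1 IHm mul1r fps_coefD fps_coefN fps_coefM.
by rewrite big_ord1 a0 mul0r subr0.
Qed.

Lemma qpoch_unit (a p : fps R) m : a 0%N = 0 -> qpoch a p m \is a GRing.unit.
Proof. by move=> a0; apply: fps_unit1; apply: qpoch_coef0. Qed.

Lemma qpoch_inf_cvg (a p : fps R) :
  p 0%N = 0 -> fps_cvg (qpoch a p) (qpoch_inf a p).
Proof.
move=> p0; suff ul : fps_cvg (qpoch a p) (Fps (fun k => qpoch a p k.+1 k)).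
  by rewrite /qpoch_inf (fps_limP ul).
move=> k; exists k.+1 => n kn /=; rewrite -(subnKC kn).
elim: (n - _)%N => [|d IHd]; first by rewrite addn0.
rewrite addnS -IHd qpochS mulrBr mulr1 mulrA fps_coefD fps_coefN.
by rewrite fps_coefMX0 ?subr0// addSn ltnS leq_addr.
Qed.

Lemma qpoch_inf_unit (a p : fps R) :
  a 0%N = 0 -> p 0%N = 0 -> qpoch_inf a p \is a GRing.unit.
Proof.
move=> a0 p0; apply: fps_unit1; have [N aN] := qpoch_inf_cvg a p0 0%N.
by rewrite -(aN N) // qpoch_coef0.
Qed.

End FpsRing.

Arguments fpsX {R}.

(* Main.v *)
Require Import Defs.
From mathcomp Require Import all_boot all_order all_algebra.
From mathcomp Require Import finmap zify ring.
Import GRing.Theory.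
Import Order.TTheory Num.Theory.
Local Open Scope ring_scope.

Set Implicit Arguments.
Unset Strict Implicit.
Unset Printing Implicit Defensive.

(** Write p = q^2, P_m = (p;p)_m, O_m = (-q;p)_m and [n,k] for the Gaussian
binomial in base p. With m = n + r the exponent n^2 + 3r^2 + 4nr is m^2 + 2mr,
and (-q;-q)_{2m} = O_m P_m, so the terms with n + r = m add up to
q^(m^2) O_m s_m / P_{2m}, where s_m = sum_r p^(mr) [m,r].

The polynomial s_m has an alternating expansion
   s_m = sum_j (-1)^j q^(j(3j+1)) [2m, m+2j]     (lemma bressoud),
which is Bressoud's finite Rogers-Ramanujan identity with p replaced by 1/p and
multiplied by p^(m^2): both sides satisfy the same pair of recurrences. It says
that s_m / P_{2m} is the beta sequence of a Bailey pair relative to 1 whose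
alpha sequence is carried by the even indices 2j. Bailey's lemma with parameters -q and
infinity, in its finite form (lemma bailey_kernel, a case of the q-analogue of
the Chu-Vandermonde sum), sends [2m, m+2j] / P_{2m} to
q^(4j^2) [2L, L+2j] / P_{2L}, whence for every L
   sum_(m <= L) q^(m^2) O_m s_m / (P_{2m} P_{L-m})
     = O_L / P_{2L} sum_j (-1)^j q^(7j^2+j) [2L, L+2j]    (finite_bailey).

As L grows, each [2L, L+2j] tends to 1 / P_oo, and the theta series
sum_j (-1)^j q^(7j^2+j) is (q^6, q^8, q^14; q^14)_oo, the limit of a finite
Jacobi triple product (finite_triple_product). Hence the double sum equals
O_oo / P_oo times that product, and O_oo / P_oo = (q^2;q^4)_oo / (q;q)_oo.
The limits are taken by comparing coefficients below a bound N, with L = 3N: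
the exponents m^2 and 7j^2+j then leave only indices below N, for which the
truncated products are already stable. *)

(** * Gaussian binomials and bilateral sums *)

Section GaussianBinomials.
Variable A : comNzRingType.
Implicit Types p q x : A.

Fixpoint gauss p n k : A :=
  match n, k with
  | _, 0%N => 1
  | 0%N, _.+1 => 0
  | n'.+1, k'.+1 => gauss p n' k' + p ^+ k * gauss p n' k
  end.

Arguments gauss : simpl never.

Lemma gaussn0 p n : gauss p n 0 = 1.
Proof. by case: n. Qed.

Lemma gaussS p n k :
  gauss p n.+1 k.+1 = gauss p n k + p ^+ k.+1 * gauss p n k.+1.
Proof. by []. Qed.

Lemma gauss_small p n k : (n < k)%N -> gauss p n k = 0.
Proof.
elim: n k => [|n IHn] [|k] //; rewrite ltnS => nk.
by rewrite gaussS !IHn ?mulr0 ?addr0 // ltnW.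
Qed.

Lemma gaussS_dual p n k : (k <= n)%N ->
  gauss p n.+1 k.+1 = gauss p n k.+1 + p ^+ (n - k) * gauss p n k.
Proof.
elim: n k => [|n IHn] k.
  by case: k => // _; rewrite gaussS (@gauss_small p 0 1) // gaussn0; ring.
case: k => [|k] kn.
  rewrite (gaussS p n.+1) {1}(IHn 0%N) // (gaussS p n 0) !gaussn0 !subn0 !exprS.
  by ring.
rewrite ltnS in kn.
rewrite gaussS [in RHS]gaussS [in X in _ = _ + X]gaussS (IHn k kn) subSS.
have [kn'|] := ltnP k n.
  rewrite (IHn k.+1 kn') -(subnSK kn') !exprS; ring.
move=> nk; have -> : k = n by lia.
rewrite subnn (gauss_small p (ltnSn n)) (gauss_small p (ltnSn n.+1)).
by rewrite (gauss_small p (ltnW (ltnSn n.+1))); ring.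
Qed.

Lemma gauss_sym p n k : (k <= n)%N -> gauss p n (n - k) = gauss p n k.
Proof.
elim: n k => [|n IHn] [|k] kn //.
  rewrite subn0 gaussn0 gaussS (gauss_small _ (ltnSn n)) mulr0 addr0.
  by have := IHn 0%N isT; rewrite subn0 gaussn0.
rewrite subSS; have [kn'|] := ltnP k n; last first.
  move=> nk; have -> : k = n by lia.
  rewrite subnn gaussn0 gaussS (gauss_small _ (ltnSn n)) mulr0 addr0.
  by rewrite -(IHn n) // subnn gaussn0.
rewrite -(subnSK kn') gaussS_dual; last lia.
by rewrite subnSK // IHn // IHn // gaussS subKn // addrC; congr (_ + _ ^+ _ * _); lia.
Qed.

(** An integer lower index makes the reflections j -> - j and j -> 1 - j of the
bilateral sums below available without boundary cases. *)
Definition gaussz p n (k : int) : A := if k is Posz k' then gauss p n k' else 0.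

Lemma gaussz_small p n (k : int) : (k < 0) || (n%:Z < k) -> gaussz p n k = 0.
Proof. by case: k => // k nk; apply: gauss_small; lia. Qed.

Lemma gaussz_sym p n (k : int) : gaussz p n (n%:Z - k) = gaussz p n k.
Proof.
have [nk|] := boolP ((k < 0) || (n%:Z < k)).
  by rewrite !gaussz_small //; lia.
case: k => k nk; last by lia.
have -> : n%:Z - k%:Z = (n - k)%N by lia.
by rewrite /gaussz gauss_sym //; lia.
Qed.

Lemma gaussz_pascal p n (k : int) :
  gaussz p n.+1 k = gaussz p n (k - 1) + p ^+ `|k| * gaussz p n k.
Proof.
case: k => [[|k]|k]; last by rewrite !gaussz_small ?mulr0 ?addr0 //; lia.
  by rewrite (@gaussz_small _ _ (0%:Z - 1)) //= !gaussn0 mulr1 add0r.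
by have -> : k.+1%:Z - 1 = k by lia.
Qed.

Lemma gaussz_pascal_dual p n (k : int) :
  gaussz p n.+1 k = gaussz p n k + p ^+ `|n.+1%:Z - k| * gaussz p n (k - 1).
Proof.
rewrite -gaussz_sym gaussz_pascal.
have -> : n.+1%:Z - k - 1 = n%:Z - k by lia.
rewrite gaussz_sym -[gaussz p n (n.+1%:Z - k)]gaussz_sym.
by have -> : n%:Z - (n.+1%:Z - k) = k - 1 by lia.
Qed.

(** Pascal's rule times a power of q. The new exponent may be negative when the
binomial it multiplies vanishes, so gaussz_pascal alone does not let exponents
be added; taking the resulting exponent b as a natural number avoids this. *)
Lemma scaled_pascal q n (k : int) (a b : nat) : b%:Z = a%:Z + 2 * k ->
  q ^+ a * gaussz (q ^+ 2) n.+1 k =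
  q ^+ a * gaussz (q ^+ 2) n (k - 1) + q ^+ b * gaussz (q ^+ 2) n k.
Proof.
move=> ab; rewrite gaussz_pascal mulrDr; congr (_ + _).
have [nk|nk] := boolP ((k < 0) || (n%:Z < k)).
  by rewrite !(gaussz_small _ nk) !mulr0.
by rewrite mulrA -exprM -exprD; congr (q ^+ _ * _); lia.
Qed.

Lemma scaled_pascal_dual q n (k : int) (a b : nat) :
  b%:Z = a%:Z + 2 * (n.+1%:Z - k) ->
  q ^+ a * gaussz (q ^+ 2) n.+1 k =
  q ^+ a * gaussz (q ^+ 2) n k + q ^+ b * gaussz (q ^+ 2) n (k - 1).
Proof.
move=> ab; rewrite gaussz_pascal_dual mulrDr; congr (_ + _).
have [nk|nk] := boolP ((k - 1 < 0) || (n%:Z < k - 1)).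
  by rewrite !(gaussz_small _ nk) !mulr0.
by rewrite mulrA -exprM -exprD; congr (q ^+ _ * _); lia.
Qed.

Definition bisum M (F : int -> A) : A := \sum_(i < M.*2.+1) F (i%:Z - M%:Z).

Lemma bisum0 F : bisum 0 F = F 0.
Proof. by rewrite /bisum big_ord1 subr0. Qed.

Lemma bisumS M F : bisum M.+1 F = F (- M.+1%:Z) + bisum M F + F M.+1%:Z.
Proof.
rewrite /bisum doubleS big_ord_recr big_ord_recl /=; congr (F _ + _ + F _).
- by rewrite sub0r.
- by apply: eq_bigr => i _; congr F; rewrite /bump /=; lia.
- by rewrite -addnn; lia.
Qed.

Lemma eq_bisum M F G : F =1 G -> bisum M F = bisum M G.
Proof. by move=> FG; rewrite /bisum; apply: eq_bigr => i _; rewrite FG. Qed.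

Lemma bisumD M F G : bisum M (fun j => F j + G j) = bisum M F + bisum M G.
Proof. exact: big_split. Qed.

Lemma bisum_distrr M F x : x * bisum M F = bisum M (fun j => x * F j).
Proof. exact: mulr_sumr. Qed.

Lemma bisum_opp M F : bisum M (fun j => F (- j)) = bisum M F.
Proof.
by elim: M => [|M IHM]; rewrite ?bisum0 ?oppr0 // !bisumS IHM opprK; ring.
Qed.

Lemma bisum_refl M F : F (- M%:Z) = 0 -> F M.+1%:Z = 0 ->
  bisum M (fun j => F (1 - j)) = bisum M F.
Proof.
move=> F1 F2.
suff: bisum M (fun j => F (1 - j)) + F (- M%:Z) = bisum M F + F M.+1%:Z.
  by rewrite F1 F2 !addr0.
elim: M {F1 F2} => [|M IHM]; first by rewrite !bisum0 subr0 oppr0 addrC.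
rewrite !bisumS.
have -> : 1 - - M.+1%:Z = M.+2%:Z by lia.
have -> : 1 - M.+1%:Z = - M%:Z by lia.
by move/(canRL (addrK _)): IHM => ->; ring.
Qed.

(** The terms at j and 1 - j cancel in pairs, and - M is the only index of the
range without a partner. Reindexing the whole sum would only show that it is
its own opposite, which is not enough in a ring with 2-torsion. *)
Lemma bisum_anti M F : (forall j, F (1 - j) = - F j) -> bisum M F = F (- M%:Z).
Proof.
move=> Fanti; elim: M => [|M IHM]; first by rewrite bisum0 oppr0.
have -> : bisum M.+1 F = F (- M.+1%:Z) + bisum M F + F (1 - - M%:Z).
  by rewrite bisumS; congr (_ + F _); lia.
by rewrite IHM Fanti; ring.
Qed.

Lemma bisum_delta M F : (forall j, j != 0 -> F j = 0) -> bisum M F = F 0.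
Proof.
move=> F0; elim: M => [|M IHM]; first exact: bisum0.
by rewrite bisumS IHM (F0 (- M.+1%:Z)) // (F0 M.+1%:Z) // add0r addr0.
Qed.

Lemma bisumN M F : bisum M (fun j => - F j) = - bisum M F.
Proof. exact: sumrN. Qed.

Lemma sign_opp (j : int) : (-1) ^+ `|- j| = (-1) ^+ `|j| :> A.
Proof. by rewrite abszN. Qed.

Lemma sign_refl (j : int) : (-1) ^+ `|1 - j| = - (-1) ^+ `|j| :> A.
Proof.
rewrite -signr_odd -[in RHS]signr_odd.
have -> : odd `|(1 - j)%R| = ~~ odd `|j| by lia.
by case: odd; rewrite /= ?expr0 ?expr1 ?opprK.
Qed.

(** * Bressoud's identity *)

Lemma gauss_absorb p n r :
  (1 - p ^+ r.+1) * gauss p n.+1 r.+1 = (1 - p ^+ n.+1) * gauss p n r.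
Proof.
have [rn|nr] := leqP r n; last by rewrite !gauss_small ?mulr0.
rewrite mulrBl mul1r {1}gaussS gaussS_dual // mulrDr mulrA -exprD.
have -> : (r.+1 + (n - r) = n.+1)%N by lia.
by ring.
Qed.

(** The Rogers-Szego polynomial of degree n, evaluated at p^a. *)
Definition rogers_szego p n a : A := \sum_(r < n.+1) p ^+ (a * r) * gauss p n r.

(** With a = n this expresses the diagonal value at n + 1 through the two values
a = n and a = n + 1 at n; together with rogers_szego_shift it determines
both sequences from their initial values. *)
Lemma rogers_szegoS p n a :
  rogers_szego p n.+1 a.+1 =
    rogers_szego p n a.+1 + p ^+ (n + a).+1 * rogers_szego p n a.
Proof.
rewrite /rogers_szego big_ord_recl /= muln0 mulr_sumr.
under eq_bigr => i _.
  rewrite /bump /= add1n gaussS_dual -1?ltnS // mulrDr mulrA -exprD.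
  have -> : (a.+1 * i.+1 + (n - i) = (n + a).+1 + a * i)%N by have := ltn_ord i; lia.
  rewrite exprD -mulrA.
over.
rewrite big_split /= addrA; congr (_ + _).
rewrite [in RHS]big_ord_recl /= muln0 !gaussn0; congr (_ + _).
by rewrite big_ord_recr /= gauss_small // mulr0 addr0.
Qed.

Lemma rogers_szego_shift p n a :
  rogers_szego p n.+1 a.+1 =
    rogers_szego p n.+1 a - (1 - p ^+ n.+1) * p ^+ a * rogers_szego p n a.
Proof.
apply/eqP; rewrite eq_sym subr_eq addrC -subr_eq eq_sym; apply/eqP.
rewrite /rogers_szego !(big_ord_recl n.+1) /= !muln0 mulr_sumr.
rewrite opprD addrACA subrr add0r.
rewrite -sumrB; apply: eq_bigr => i _; rewrite /bump /= add1n.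
have := gauss_absorb p n i; rewrite mulSn exprD mulnS exprD => e.
rewrite [LHS](_ : _ = p ^+ a * p ^+ (a * i) *
  ((1 - p ^+ n.+1) * gauss p n i)); last by ring.
by rewrite -e; ring.
Qed.

(** sigma and tau are the alternating expansions, in base q^2, of the
Rogers-Szego values at a = n and a = n + 1. The exponents are those of base q,
twice the pentagonal numbers, which avoids a division by 2. The terms vanish
unless - n <= 2j <= n + 1, so one bound M serves all n <= M. *)
Definition sigma q M n : A := bisum M (fun j => (-1) ^+ `|j| *
  (q ^+ `|j * (3 * j + 1)| * gaussz (q ^+ 2) n.*2 (n%:Z + 2 * j))).

Definition tau q M n : A := bisum M (fun j => (-1) ^+ `|j| *
  (q ^+ `|j * (3 * j - 1)| * gaussz (q ^+ 2) n.*2.+1 (n%:Z + 2 * j))).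

Lemma sigmaE q M n : sigma q M n = bisum M (fun j => (-1) ^+ `|j| *
  (q ^+ `|j * (3 * j - 1)| * gaussz (q ^+ 2) n.*2 (n%:Z + 2 * j))).
Proof.
rewrite /sigma -bisum_opp; apply: eq_bisum => j; rewrite sign_opp.
congr (_ * (q ^+ _ * _)); first lia.
by rewrite -gaussz_sym; congr gaussz; lia.
Qed.

Lemma tauE q M n : tau q M n = bisum M (fun j => (-1) ^+ `|j| *
  (q ^+ `|j * (3 * j + 1)| * gaussz (q ^+ 2) n.*2.+1 (n.+1%:Z + 2 * j))).
Proof.
rewrite /tau -bisum_opp; apply: eq_bisum => j; rewrite sign_opp.
congr (_ * (q ^+ _ * _)); first lia.
by rewrite -gaussz_sym; congr gaussz; lia.
Qed.

(** Split [2n+2, n+1+2j] by one Pascal rule and one of the resulting binomials by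
the other. Of the three sums one is tau, one is a multiple of sigma, and the
third is antisymmetric under j -> 1 - j. *)
Lemma sigmaS q M n : (n < M)%N ->
  sigma q M n.+1 = tau q M n + (q ^+ 2) ^+ n.*2.+1 * sigma q M n.
Proof.
move=> nM; rewrite tauE /sigma bisum_distrr.
pose X j := (-1) ^+ `|j| *
  (q ^+ `|3 * j * j - 3 * j + (n.+1).*2%:Z| * gaussz (q ^+ 2) n.*2 (n%:Z + 2 * j - 1)).
have X0 : bisum M X = 0.
  rewrite bisum_anti => [|j]; first by rewrite /X gaussz_small ?mulr0 //; lia.
  rewrite /X sign_refl mulNr; congr (- (_ * (q ^+ _ * _))); first lia.
  by rewrite -gaussz_sym; congr gaussz; lia.
rewrite -[RHS]addr0 -X0 -!bisumD; apply: eq_bisum => j; rewrite /X doubleS.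
rewrite (@scaled_pascal_dual q n.*2.+1 (n.+1%:Z + 2 * j) _
  `|(3 * j * j - 3 * j + (n.+1).*2%:Z)%R|%N); last by nia.
have -> : n.+1%:Z + 2 * j - 1 = n%:Z + 2 * j by lia.
rewrite (@scaled_pascal q n.*2 (n%:Z + 2 * j) _
  (2 * n.*2.+1 + `|(j * (3 * j + 1))%R|)%N); last by nia.
by rewrite exprD exprM; ring.
Qed.

(** Pascal's rule gives tau = sigma + X at n + 1; the reflection j -> 1 - j,
followed by Pascal's rule, turns X into a multiple of tau at n minus Y, and
Y is again a multiple of tau at n by the same reflection. *)
Lemma tauS q M n : (n < M)%N ->
  tau q M n.+1 =
    sigma q M n.+1 - (1 - (q ^+ 2) ^+ n.+1) * (q ^+ 2) ^+ n.+1 * tau q M n.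
Proof.
move=> nM.
pose X j := (-1) ^+ `|j| * (q ^+ `|3 * j * j - 5 * j + (n.+2).*2%:Z| *
  gaussz (q ^+ 2) (n.+1).*2 (n%:Z + 2 * j)).
pose Y j := (-1) ^+ `|j| * (q ^+ `|3 * j * j - 5 * j + (n.*2.+3).*2%:Z| *
  gaussz (q ^+ 2) n.*2.+1 (n%:Z + 2 * j - 1)).
have tauX : tau q M n.+1 = sigma q M n.+1 + bisum M X.
  rewrite sigmaE /tau -bisumD; apply: eq_bisum => j; rewrite /X.
  rewrite (@scaled_pascal_dual q (n.+1).*2 (n.+1%:Z + 2 * j) _
    `|(3 * j * j - 5 * j + (n.+2).*2%:Z)%R|%N); last by nia.
  by rewrite mulrDr; congr (_ + _ * (_ * gaussz _ _ _)); lia.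
have XY : bisum M X = - ((q ^+ 2) ^+ n.+1 * tau q M n) - bisum M Y.
  rewrite -bisum_refl; [|by rewrite /X gaussz_small ?mulr0 //; lia..].
  rewrite /tau bisum_distrr -!bisumN -bisumD; apply: eq_bisum => j.
  rewrite /X /Y sign_refl.
  have -> : gaussz (q ^+ 2) (n.+1).*2 (n%:Z + 2 * (1 - j))
    = gaussz (q ^+ 2) n.*2.+2 (n%:Z + 2 * j).
    by rewrite -gaussz_sym; congr gaussz; lia.
  have -> : `|(3 * (1 - j) * (1 - j) - 5 * (1 - j) + (n.+2).*2%:Z)%R|%N
     = (2 * n.+1 + `|(j * (3 * j - 1))%R|)%N by nia.
  rewrite (@scaled_pascal_dual q n.*2.+1 (n%:Z + 2 * j) _
    `|(3 * j * j - 5 * j + (n.*2.+3).*2%:Z)%R|%N); last by nia.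
  by rewrite exprD exprM; ring.
have Ytau : bisum M Y = - ((q ^+ 2) ^+ n.+1 * (q ^+ 2) ^+ n.+1 * tau q M n).
  rewrite -bisum_refl; [|by rewrite /Y gaussz_small ?mulr0 //; lia..].
  rewrite /tau bisum_distrr -!bisumN; apply: eq_bisum => j.
  rewrite /Y sign_refl.
  have -> : gaussz (q ^+ 2) n.*2.+1 (n%:Z + 2 * (1 - j) - 1)
    = gaussz (q ^+ 2) n.*2.+1 (n%:Z + 2 * j).
    by rewrite -gaussz_sym; congr gaussz; lia.
  have -> : `|(3 * (1 - j) * (1 - j) - 5 * (1 - j) + (n.*2.+3).*2%:Z)%R|%N
     = (2 * n.+1 + (2 * n.+1 + `|(j * (3 * j - 1))%R|))%N by nia.
  by rewrite !exprD exprM; ring.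
by rewrite tauX XY Ytau; ring.
Qed.

(** Bressoud's finite form of the Rogers-Ramanujan identity, in the base inverse to
the usual one. The companion tau only carries the induction. *)
Lemma bressoud q M n : (n <= M)%N ->
  rogers_szego (q ^+ 2) n n = sigma q M n /\ rogers_szego (q ^+ 2) n n.+1 = tau q M n.
Proof.
elim: n => [_|n IHn nM].
  rewrite /rogers_szego !big_ord1 /= /sigma /tau !bisum_delta /= ?mul0r ?expr0 ?mul1r //.
    by move=> j j0; rewrite gaussz_small ?mulr0 //; lia.
  by move=> j j0; rewrite gaussz_small ?mulr0 //; lia.
have [sE tE] := IHn (ltnW nM).
have sE' : rogers_szego (q ^+ 2) n.+1 n.+1 = sigma q M n.+1.
  by rewrite rogers_szegoS sE tE sigmaS // addnn.
by split=> //; rewrite rogers_szego_shift sE' tE tauS.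
Qed.

End GaussianBinomials.

Arguments gauss {A} p n k : simpl never.
Arguments gaussz {A} p n k : simpl never.

(** * Finite sums of q-Pochhammer products *)

Section QPochhammer.
Variable R : comNzRingType.
Implicit Types (a b p q f g : fps R).

Lemma qpoch0 a p : qpoch a p 0 = 1.
Proof. by rewrite /qpoch big_geq. Qed.

Lemma qpochD a p m n :
  qpoch a p (m + n) = qpoch a p m * qpoch (a * p ^+ m) p n.
Proof.
elim: n => [|n IHn]; first by rewrite addn0 qpoch0 mulr1.
by rewrite addnS !qpochS IHn exprD !mulrA.
Qed.

Lemma qpochSl a p m : qpoch a p m.+1 = (1 - a) * qpoch (a * p) p m.
Proof. by rewrite -add1n qpochD qpochS qpoch0 mul1r expr0 mulr1 expr1. Qed.

(** The terminating q-Chu-Vandermonde sum, with denominators cleared. The induction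
varies a: the dual Pascal rule writes the sum for n + 1 through the sums for n
at a and at a * p, and both of these equal (b;p)_n. *)
Lemma chu_vandermonde p a b n :
  \sum_(k < n.+1) gauss p n k * qpoch a p k * qpoch (a * b * p ^+ k) p (n - k)
     * (p ^+ 'C(k, 2) * (- b) ^+ k) = qpoch b p n.
Proof.
elim: n a => [|n IHn] a.
  by rewrite big_ord1 !qpoch0 gaussn0 !expr0 !mulr1.
pose t a k := gauss p n k * qpoch a p k * qpoch (a * b * p ^+ k) p (n - k)
     * (p ^+ 'C(k, 2) * (- b) ^+ k).
have IHn' c : \sum_(k < n.+1) t c k = qpoch b p n by exact: IHn.
have tS (k : 'I_n.+1) :
    gauss p n k * qpoch a p k * qpoch (a * b * p ^+ k) p (n.+1 - k)
     * (p ^+ 'C(k, 2) * (- b) ^+ k) = (1 - a * b * p ^+ n) * t a k.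
  have kn : (k <= n)%N by rewrite -ltnS.
  rewrite subSn // qpochS -mulrA -[in _ * p ^+ (n - k)]mulrA -exprD subnKC //.
  by rewrite mulrA /t; ring.
have tS' (k : 'I_n.+1) :
    p ^+ (n - k) * gauss p n k * qpoch a p k.+1 * qpoch (a * b * p ^+ k.+1) p (n - k)
     * (p ^+ 'C(k.+1, 2) * (- b) ^+ k.+1) = - b * p ^+ n * (1 - a) * t (a * p) k.
  have kn : (k <= n)%N by rewrite -ltnS.
  rewrite /t qpochSl binS bin1 exprD !exprS.
  have -> : a * p * b * p ^+ k = a * b * (p * p ^+ k) by ring.
  have -> : p ^+ n = p ^+ (n - k) * p ^+ k by rewrite -exprD subnK.
  by ring.
transitivity ((1 - a * b * p ^+ n) * \sum_(k < n.+1) t a k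
   - b * p ^+ n * (1 - a) * \sum_(k < n.+1) t (a * p) k); last first.
  by rewrite !IHn' qpochS; ring.
rewrite big_ord_recl.
under eq_bigr => k _.
  rewrite lift0 gaussS_dual -1?ltnS // subSS !mulrDl tS'.
over.
rewrite big_split /= addrA -mulr_sumr !mulNr; congr (_ + _).
rewrite mulr_sumr -(eq_bigr _ (fun k _ => tS k)).
rewrite [in RHS]big_ord_recl; congr (_ + _).
  by rewrite !gaussn0.
rewrite big_ord_recr /= gauss_small // !mul0r addr0.
by apply: eq_bigr => k _; rewrite /bump /= add1n subSS.
Qed.

Lemma gauss_qpoch p k m :
  gauss p (k + m) k * (qpoch p p k * qpoch p p m) = qpoch p p (k + m).
Proof.
elim: k m => [|k IHk] m; first by rewrite gaussn0 qpoch0 !mul1r.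
elim: m => [|m IHm].
  by rewrite !addn0 -gauss_sym // subnn gaussn0 qpoch0 mul1r mulr1.
have := IHk m.+1; have := IHm.
rewrite !addSn !addnS !qpochS (gaussS p (k + m).+1) => e1 e2.
transitivity ((1 - p * p ^+ k) * (gauss p (k + m).+1 k *
    (qpoch p p k * (qpoch p p m * (1 - p * p ^+ m))))
  + (1 - p * p ^+ m) * p ^+ k.+1 * (gauss p (k + m).+1 k.+1 *
    (qpoch p p k * (1 - p * p ^+ k) * qpoch p p m))); first by rewrite exprS; ring.
by rewrite e1 e2 !exprS exprD; ring.
Qed.

(** Gauss's q-binomial theorem in homogeneous form, so that w may be chosen to be
a power of q. *)
Lemma gauss_binomial p (w : fps R) n :
  \prod_(j < n) (w - p ^+ j) =
  \sum_(k < n.+1) gauss p n k * ((-1) ^+ k * p ^+ 'C(k, 2) * w ^+ (n - k)).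
Proof.
elim: n => [|n IHn].
  by rewrite big_ord0 big_ord1 gaussn0 !expr0 !mulr1.
rewrite big_ord_recr /= IHn [RHS]big_ord_recl.
under [in RHS]eq_bigr => k _.
  rewrite lift0 gaussS_dual -1?ltnS // subSS binS bin1 exprD exprS.
  rewrite mulrDl.
  have -> : p ^+ (n - k) * gauss p n k *
      (-1 * (-1) ^+ k * (p ^+ 'C(k, 2) * p ^+ k) * w ^+ (n - k)) =
     gauss p n k * ((-1) ^+ k * p ^+ 'C(k, 2) * w ^+ (n - k)) * - p ^+ n.
    have -> : p ^+ n = p ^+ (n - k) * p ^+ k by rewrite -exprD subnK // -ltnS.
    by ring.
over.
rewrite big_split /= addrA -mulr_suml mulrDr; congr (_ + _).
rewrite big_ord_recl [in RHS]big_ord_recr /= (gauss_small p (ltnSn n)) mul0r addr0.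
rewrite mulrDl !gaussn0 mulr_suml; congr (_ + _).
  by rewrite !subn0 exprSr !mul1r.
apply: eq_bigr => k _; rewrite /bump /= add1n binS bin1 exprD exprS.
have -> : (n - k = (n - k.+1).+1)%N by have := ltn_ord k; lia.
by rewrite exprS; ring.
Qed.

Lemma coef0_exp f n : f 0%N = 0 -> (0 < n)%N -> (f ^+ n) 0%N = 0.
Proof. by move=> f0 n0; rewrite -[f ^+ n]mul1r fps_coefMX0. Qed.

Lemma eq_divr_unit (a b u v : fps R) : u \is a GRing.unit -> v \is a GRing.unit ->
  a * v = b * u -> a / u = b / v.
Proof. by move=> uu uv e; apply: (canLR (mulrK uu)); rewrite mulrAC -e mulrK. Qed.

Lemma gauss_div p k m : p 0%N = 0 ->
  gauss p (k + m) k / qpoch p p (k + m) = (qpoch p p k * qpoch p p m)^-1.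
Proof.
move=> p0; rewrite -[RHS]mul1r; apply: eq_divr_unit; rewrite ?unitrM ?qpoch_unit //.
by rewrite gauss_qpoch mul1r.
Qed.

(** * A finite Bailey lemma *)

Section Kernel.
Variable q : fps R.
Hypothesis q0 : q 0%N = 0.

Let p := q ^+ 2.
Let P m := qpoch p p m.
Let O m := qpoch (- q) p m.

Let p0 : p 0%N = 0. Proof. exact: coef0_exp. Qed.
Let Pu m : P m \is a GRing.unit. Proof. exact: qpoch_unit. Qed.

(** chu_vandermonde at a = b = - q^(2J+1), multiplied by
O_J q^(J^2) / (P_M P_(2J+M)). *)
Lemma bailey_kernel_nat (J M : nat) :
  \sum_(k < M.+1) q ^+ ((J + k) ^ 2) * O (J + k) / (P (J.*2 + k) * P k) / P (M - k)
  = O (J + M) * q ^+ (J ^ 2) / (P (J.*2 + M) * P M).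
Proof.
pose b := - q * p ^+ J.
have Od n : O (J + n) = O J * qpoch b p n by exact: qpochD.
rewrite Od -(chu_vandermonde p b b) mulr_sumr !mulr_suml; apply: eq_bigr => k _.
have kM : (k <= M)%N by rewrite -ltnS.
rewrite -mulrA -invrM ?unitrM ?Pu //; apply: eq_divr_unit; rewrite ?unitrM ?Pu //.
rewrite Od.
have -> : P (J.*2 + M) = P (J.*2 + k) * qpoch (b * b * p ^+ k) p (M - k).
  have -> : (J.*2 + M = J.*2 + k + (M - k))%N by lia.
  rewrite /P qpochD; congr (_ * qpoch _ _ _).
  by rewrite /b /p -addnn !exprD; ring.
have -> : P M = gauss p M k * (P k * P (M - k)).
  by have := gauss_qpoch p k (M - k); rewrite subnKC.
have -> : q ^+ ((J + k) ^ 2) = q ^+ (J ^ 2) * (p ^+ 'C(k, 2) * (- b) ^+ k).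
  have -> : - b = q * p ^+ J by rewrite /b; ring.
  rewrite (exprMn k q) /p -!exprM -!exprD; congr (_ ^+ _).
  by have := mul_bin_diag k 1; rewrite bin1; case: (nat_of_ord k) => [|n] /=; nia.
ring.
Qed.

(** The finite Bailey lemma relative to 1 with parameters - q and infinity, on the
single pair whose alpha sequence is supported at J: the sum over m only
multiplies alpha by q^(J^2). *)
Lemma bailey_kernel (L : nat) (J : int) :
  \sum_(m < L.+1) q ^+ (m ^ 2) * O m * (gaussz p m.*2 (m%:Z + J) / P m.*2) / P (L - m)
  = O L * q ^+ (`|J| ^ 2) * (gaussz p L.*2 (L%:Z + J) / P L.*2).
Proof.
wlog J0 : J / 0 <= J => [WL|].
  have [|J0] := leP 0 J; first exact: WL.
  rewrite -[in RHS]gaussz_sym -[in RHS](abszN J).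
  have -> : L.*2%:Z - (L%:Z + J) = L%:Z - J by lia.
  rewrite -WL; last by lia.
  apply: eq_bigr => m _; rewrite -gaussz_sym; congr (_ * (gaussz _ _ _ / _) / _).
  by lia.
case: J J0 => // J _.
have [LJ|JL] := ltnP L J.
  rewrite gaussz_small; last by lia.
  rewrite mul0r mulr0 big1 // => m _; have mL := ltn_ord m.
  by rewrite gaussz_small ?mul0r ?mulr0 ?mul0r //; lia.
have binE k : gaussz p (J + k).*2 ((J + k)%N%:Z + J%:Z) / P (J + k).*2
   = (P (J.*2 + k) * P k)^-1.
  have -> : (J + k)%N%:Z + J%:Z = (J.*2 + k)%N%:Z by lia.
  rewrite -gauss_div //.
  by have -> : ((J + k).*2 = J.*2 + k + k)%N by lia.
rewrite -(subnKC JL) binE -addnS big_split_ord /= big1 ?add0r; last first.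
  move=> m _; have mJ := ltn_ord m.
  by rewrite gaussz_small ?mul0r ?mulr0 ?mul0r //; lia.
rewrite -bailey_kernel_nat; apply: eq_bigr => k _.
by rewrite binE subnDl.
Qed.

(** Expand the Rogers-Szego values by bressoud, exchange the sums and apply
bailey_kernel at J = 2j; the exponents j(3j+1) and (2j)^2 add to j(7j+1). *)
Lemma finite_bailey (L M : nat) : (L <= M)%N ->
  \sum_(m < L.+1) q ^+ (m ^ 2) * O m * (rogers_szego p m m / P m.*2) / P (L - m)
  = O L / P L.*2 * bisum M (fun j => (-1) ^+ `|j| *
     (q ^+ `|j * (7 * j + 1)| * gaussz p L.*2 (L%:Z + j * 2))).
Proof.
move=> LM.
transitivity (\sum_(m < L.+1) bisum M (fun j => (-1) ^+ `|j| * q ^+ `|j * (3 * j + 1)| *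
   (q ^+ (m ^ 2) * O m * (gaussz p m.*2 (m%:Z + 2 * j) / P m.*2) / P (L - m)))).
  apply: eq_bigr => m _; have mM : (m <= M)%N by have := ltn_ord m; lia.
  rewrite (bressoud q mM).1 /sigma /bisum mulr_suml mulr_sumr mulr_suml.
  by apply: eq_bigr => i _; rewrite /p; ring.
rewrite exchange_big /= bisum_distrr; apply: eq_bigr => i _.
rewrite -mulr_sumr bailey_kernel; set j := _ - M%:Z.
have -> : `|(j * (7 * j + 1))%R|%N = (`|(j * (3 * j + 1))%R| + `|(2 * j)%R| ^ 2)%N by nia.
by rewrite exprD [2 * j]mulrC; ring.
Qed.

End Kernel.

(** * A finite Jacobi triple product *)

Lemma fpsX_coefS f k : (fpsX * f) k.+1 = f k.
Proof.
rewrite fps_coefM big_ord_recl /= mul0r add0r big_ord_recl /= mul1r subSS subn0.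
by rewrite big1 ?addr0 // => i _; rewrite mul0r.
Qed.

Lemma fpsXn_coef f e k : (fpsX ^+ e * f) (e + k)%N = f k.
Proof.
by elim: e => [|e IHe]; rewrite ?expr0 ?mul1r // exprS -mulrA addSn fpsX_coefS.
Qed.

Lemma fpsXn_cancel e f g : fpsX ^+ e * f = fpsX ^+ e * g -> f = g.
Proof. by move=> fg; apply: fpsP => k; rewrite -(fpsXn_coef f e) fg fpsXn_coef. Qed.

Lemma mul2_bin2 k : (2 * 'C(k, 2) + k = k * k)%N.
Proof. by have := mul_bin_diag k 1; rewrite bin1; case: k => [|k] /=; nia. Qed.

Lemma absz_theta_exponent (j : int) : `|(j * (7 * j + 1))%R|%N%:Z = j * (7 * j + 1).
Proof. by nia. Qed.

Lemma triple_product_exponent m k : (0 < m)%N -> (k <= m.*2)%N ->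
  (14 * 'C(k, 2) + (14 * m.-1 + 6) * (m.*2 - k) =
   14 * 'C(m, 2) + (14 * m.-1 + 6) * m
     + `|((k%:Z - m%:Z) * (7 * (k%:Z - m%:Z) + 1))%R|)%N.
Proof.
move=> m0 km; have := mul2_bin2 k; have := mul2_bin2 m.
have := absz_theta_exponent (k%:Z - m%:Z).
have : (14 * m.-1 + 6)%N%:Z = 14 * m%:Z - 8 by lia.
have : (m.*2 - k)%N%:Z = 2 * m%:Z - k%:Z by lia.
move: 'C(k, 2) 'C(m, 2) (14 * m.-1 + 6)%N (m.*2 - k)%N (absz _).
move=> ck cm w d v dE wE vE mE kE.
have wd : (w * d)%N%:Z = (14 * m%:Z - 8) * (2 * m%:Z - k%:Z).
  by rewrite PoszM dE wE.
have wm : (w * m)%N%:Z = (14 * m%:Z - 8) * m%:Z by rewrite PoszM wE.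
lia.
Qed.

Lemma prod_Nexp p n : \prod_(j < n) - p ^+ j = (-1) ^+ n * p ^+ 'C(n, 2).
Proof.
elim: n => [|n IHn]; first by rewrite big_ord0 !expr0 mulr1.
by rewrite big_ord_recr /= IHn binS bin1 exprD exprS; ring.
Qed.

(** gauss_binomial with 2M factors in base q^14 and w = q^(14M-8). The first M
factors, up to signs and powers of q, give (q^6;q^14)_M read backwards, the
last M give (q^8;q^14)_M. Powers of q are not invertible, so the common power
q^e is carried along and cancelled at the end. *)
Lemma finite_triple_product (M : nat) (q := fpsX : fps R) :
  bisum M (fun j => (-1) ^+ `|j| *
     (q ^+ `|j * (7 * j + 1)| * gaussz (q ^+ 14) M.*2 (M%:Z + j)))
  = qpoch (q ^+ 6) (q ^+ 14) M * qpoch (q ^+ 8) (q ^+ 14) M.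
Proof.
case: M => [|M'].
  by rewrite bisum0 !qpoch0 mul0r addr0 /gaussz gaussn0 !expr0 !mul1r.
(* 14 M' + 6 is 14 M - 8 without subtraction. *)
set M := M'.+1; pose w := q ^+ (14 * M' + 6); pose p := q ^+ 14.
pose e := (14 * 'C(M, 2) + (14 * M' + 6) * M)%N.
have prodE : \prod_(j < M.*2) (w - p ^+ j) =
   (-1) ^+ M * q ^+ e * (qpoch (q ^+ 6) p M * qpoch (q ^+ 8) p M).
  rewrite -addnn big_split_ord /=.
  have -> : \prod_(j < M) (w - p ^+ j) =
     (-1) ^+ M * p ^+ 'C(M, 2) * qpoch (q ^+ 6) p M.
    rewrite -prod_Nexp /qpoch big_mkord [X in _ * X](reindex_inj rev_ord_inj) /=.
    rewrite -big_split; apply: eq_bigr => j _ /=.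
    have -> : w = p ^+ j * (q ^+ 6 * p ^+ (M - j.+1)).
      rewrite /w /p -!exprM -!exprD; congr (q ^+ _).
      by have := ltn_ord j; rewrite /M; lia.
    by ring.
  have -> : \prod_(j < M) (w - p ^+ (M + j)) = w ^+ M * qpoch (q ^+ 8) p M.
    rewrite -[in w ^+ M](card_ord M) -prodr_const /qpoch big_mkord -big_split.
    apply: eq_bigr => j _ /=.
    have -> : p ^+ (M + j) = w * (q ^+ 8 * p ^+ j).
      rewrite /w /p -!exprM -!exprD; congr (q ^+ _).
      by rewrite /M; lia.
    by ring.
  by rewrite /e exprD !exprM -/p -/w; ring.
have sumE : \prod_(j < M.*2) (w - p ^+ j) = (-1) ^+ M * q ^+ e *
   bisum M (fun j => (-1) ^+ `|j| *
     (q ^+ `|j * (7 * j + 1)| * gaussz p M.*2 (M%:Z + j))).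
  rewrite gauss_binomial bisum_distrr; apply: eq_bigr => k _.
  have -> : M%:Z + (k%:Z - M%:Z) = k by lia.
  have -> : (-1) ^+ k = (-1) ^+ M * (-1) ^+ `|(k%:Z - M%:Z)%R| :> fps R.
    rewrite -exprD -signr_odd -[in RHS]signr_odd; congr (_ ^+ (nat_of_bool _)).
    by lia.
  rewrite [LHS](_ : _ = (-1) ^+ M * (-1) ^+ `|(k%:Z - M%:Z)%R| *
     (p ^+ 'C(k, 2) * w ^+ (M.*2 - k)) * gauss p M.*2 k); last by rewrite mulrC -!mulrA.
  have -> : p ^+ 'C(k, 2) * w ^+ (M.*2 - k) =
     q ^+ e * q ^+ `|((k%:Z - M%:Z) * (7 * (k%:Z - M%:Z) + 1))%R|.
    rewrite /p /w -!exprM -!exprD; congr (q ^+ _).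
    have kM : (k <= M.*2)%N by rewrite -ltnS.
    exact: triple_product_exponent.
  by rewrite /gaussz; ring.
have : q ^+ e * ((-1) ^+ M * (qpoch (q ^+ 6) p M * qpoch (q ^+ 8) p M)) =
  q ^+ e * ((-1) ^+ M * bisum M (fun j => (-1) ^+ `|j| *
     (q ^+ `|j * (7 * j + 1)| * gaussz p M.*2 (M%:Z + j)))).
  by rewrite mulrCA mulrA -prodE sumE mulrA [q ^+ e * _]mulrC.
by move/fpsXn_cancel/(can_inj (signrMK M)).
Qed.

End QPochhammer.

(** * Congruence modulo a power of q *)

Section Congruence.
Variables (R : comNzRingType) (N : nat).
Implicit Types (a b p f g h : fps R).

Definition eqm f g := forall k, (k < N)%N -> f k = g k.

Lemma eqm_refl f : eqm f f. Proof. by []. Qed.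

Lemma eqm_sym f g : eqm f g -> eqm g f.
Proof. by move=> fg k kN; rewrite fg. Qed.

Lemma eqm_trans g f h : eqm f g -> eqm g h -> eqm f h.
Proof. by move=> fg gh k kN; rewrite fg ?gh. Qed.

Lemma eqmM f1 f2 g1 g2 : eqm f1 g1 -> eqm f2 g2 -> eqm (f1 * f2) (g1 * g2).
Proof.
move=> e1 e2 k kN; rewrite !fps_coefM; apply: eq_bigr => i _.
by rewrite e1 ?e2 //; have := ltn_ord i; lia.
Qed.

Lemma eqm_sum (I : Type) (s : seq I) (Q : pred I) (F G : I -> fps R) :
  (forall i, Q i -> eqm (F i) (G i)) ->
  eqm (\sum_(i <- s | Q i) F i) (\sum_(i <- s | Q i) G i).
Proof. by move=> FG k kN; rewrite !fps_coef_sum; apply: eq_bigr => i /FG ->. Qed.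

Lemma eqm_cancel f g h : h \is a GRing.unit -> eqm (f * h) (g * h) -> eqm f g.
Proof. by move=> hu /eqmM /(_ (eqm_refl h^-1)); rewrite !mulrK. Qed.

Lemma eqm_Xn e f : (N <= e)%N -> eqm (fpsX ^+ e * f) 0.
Proof. by move=> Ne k kN; rewrite mulrC fps_coefMX0 // (leq_trans kN). Qed.

Lemma eqm_qpoch_trunc a p n : p 0%N = 0 -> (N <= n)%N ->
  eqm (qpoch a p n) (qpoch a p N).
Proof.
move=> p0 Nn k kN; rewrite -(subnKC Nn); elim: (n - N)%N => [|d IHd].
  by rewrite addn0.
rewrite addnS -IHd qpochS mulrBr mulr1 mulrA fps_coefD fps_coefN.
by rewrite fps_coefMX0 ?subr0 // ltn_addr.
Qed.

Lemma eqm_qpoch_inf a p n : p 0%N = 0 -> (N <= n)%N ->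
  eqm (qpoch_inf a p) (qpoch a p n).
Proof.
move=> p0 Nn k kN; have [K aK] := qpoch_inf_cvg a p0 k.
rewrite -(aK (maxn K n)) ?leq_maxl // eqm_qpoch_trunc //; last by rewrite leq_max Nn orbT.
by rewrite [RHS]eqm_qpoch_trunc.
Qed.

Lemma eqm_qpoch a p m n : p 0%N = 0 -> (N <= m)%N -> (N <= n)%N ->
  eqm (qpoch a p m) (qpoch a p n).
Proof. by move=> p0 Nm Nn k kN; rewrite eqm_qpoch_trunc // [RHS]eqm_qpoch_trunc. Qed.

(** [n,k] = P_n / (P_k P_(n-k)), and all these products agree with P_L up to
order N. *)
Lemma eqm_gauss p n (k : int) L : p 0%N = 0 ->
  N%:Z <= k -> N%:Z <= n%:Z - k -> (N <= L)%N ->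
  eqm (gaussz p n k * qpoch p p L) 1.
Proof.
move=> p0; case: k => // k Nk Nnk NL.
have nE : (n = k + (n - k))%N by lia.
apply: (@eqm_cancel _ _ (qpoch p p L)); first exact: qpoch_unit.
rewrite mul1r -mulrA.
apply: (@eqm_trans (gauss p n k * (qpoch p p k * qpoch p p (n - k)))).
  by apply: eqmM => //; apply: eqmM; apply: eqm_qpoch => //; lia.
by rewrite nE addKn gauss_qpoch; apply: eqm_qpoch => //; lia.
Qed.

(** Multiplied by P_L, the binomials in the bilateral sum become 1: terms with
|j| >= N vanish modulo q^N, and for |j| < N both L + jc and L - jc are at least
N because L >= 3N and c <= 2. The case c = 2 serves finite_bailey, the case
c = 1 finite_triple_product. *)
Lemma eqm_theta L (c : int) p (q := fpsX : fps R) : p 0%N = 0 ->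
  (0 < c <= 2) -> (3 * N <= L)%N ->
  eqm (bisum L (fun j => (-1) ^+ `|j| *
         (q ^+ `|j * (7 * j + 1)| * gaussz p L.*2 (L%:Z + j * c))) * qpoch p p L)
      (bisum L (fun j => (-1) ^+ `|j| * q ^+ `|j * (7 * j + 1)|)).
Proof.
move=> p0 c2 NL; rewrite mulrC bisum_distrr; apply: eqm_sum => i _.
set j := _ - _.
have [jN|Nj] := ltnP `|j| N; last first.
  have Ne : (N <= `|(j * (7 * j + 1))%R|)%N by nia.
  apply: (@eqm_trans 0); last first.
    by apply: eqm_sym; rewrite mulrC; apply: eqm_Xn.
  rewrite [X in eqm X _](_ : _ = q ^+ `|(j * (7 * j + 1))%R| * ((-1) ^+ `|j| *
    (qpoch p p L * gaussz p L.*2 (L%:Z + j * c)))); last by ring.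
  exact: eqm_Xn.
rewrite -[X in eqm _ X]mulr1 mulrC -!mulrA; apply: eqmM => //; apply: eqmM => //.
by apply: eqm_gauss => //; nia.
Qed.

(** Eliminates the theta series t between the finite Bailey identity, where
u = P_L, v = P_2L and w = O_L, and the finite triple product b2. *)
Lemma eqm_assemble S u v b1 b2 c t w : v \is a GRing.unit ->
  eqm S (w / v * b1 * u) -> eqm (b1 * u) t -> eqm (b2 * c) t -> eqm u v ->
  eqm (S * u) (b2 * c * w).
Proof.
move=> vu e1 t1 t2 uv.
apply: eqm_trans (eqmM e1 (@eqm_refl u)) _.
have -> : w / v * b1 * u * u = (b1 * u) * (u * v^-1 * w) by ring.
apply: eqmM; first by apply: eqm_trans t1 (eqm_sym t2).
rewrite -[X in eqm _ X]mul1r -(mulrV vu); apply: eqmM => //.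
exact: eqmM.
Qed.

End Congruence.

(** * The double sum *)

Section Main.
Variable R : comNzRingType.
Let q : fps R := fpsX.
Let p := q ^+ 2.
Let P m := qpoch p p m.
Let O m := qpoch (- q) p m.

Let F (nr : nat * nat) : fps R := let: (n, r) := nr in
       q ^+ (n ^ 2 + 3 * r ^ 2 + 4 * n * r)
         * qpoch (- q) (- q) (2 * n + 2 * r)
       / (qpoch (q ^+ 2) (q ^+ 2) (2 * n + 2 * r)
          * qpoch (q ^+ 2) (q ^+ 2) r * qpoch (q ^+ 2) (q ^+ 2) n).

Let q0 : q 0%N = 0. Proof. by []. Qed.
Let p0 : p 0%N = 0. Proof. exact: coef0_exp. Qed.
Let Pu m : P m \is a GRing.unit. Proof. exact: qpoch_unit. Qed.

Lemma qpoch_split (a b : fps R) m :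
  qpoch a b m.*2 = qpoch a (b ^+ 2) m * qpoch (a * b) (b ^+ 2) m.
Proof.
elim: m => [|m IHm]; first by rewrite !qpoch0 mulr1.
rewrite doubleS !qpochS IHm -!exprM mul2n (exprS b m.*2); ring.
Qed.

Lemma qpochs_inf3 (a b c d : fps R) :
  qpochs_inf [:: a; b; c] d = qpoch_inf a d * qpoch_inf b d * qpoch_inf c d.
Proof. by rewrite /qpochs_inf !big_cons big_nil mulr1 mulrA. Qed.

Lemma qpoch_base_oppq m : qpoch (- q) (- q) m.*2 = O m * P m.
Proof. by rewrite qpoch_split mulrNN sqrrN. Qed.

(** The inner sum over n + r = m is a Rogers-Szego value since the exponent is
m^2 + 2mr. *)
Lemma sum_diag m : \sum_(r < m.+1) F ((m - r)%N, nat_of_ord r) =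
  q ^+ (m ^ 2) * O m * (rogers_szego p m m / P m.*2).
Proof.
rewrite /rogers_szego mulr_suml mulr_sumr; apply: eq_bigr => r _.
have rm : (r <= m)%N by rewrite -ltnS.
rewrite /F.
have -> : (2 * (m - r) + 2 * r = m.*2)%N by lia.
have -> : ((m - r) ^ 2 + 3 * r ^ 2 + 4 * (m - r) * r = m ^ 2 + 2 * (m * r))%N by nia.
rewrite qpoch_base_oppq exprD exprM -/p -/(P _) -/(P r) -/(P (m - r)) [RHS]mulrA.
apply: eq_divr_unit; rewrite ?unitrM ?Pu //.
have -> : P m = gauss p m r * (P r * P (m - r)).
  by have := gauss_qpoch p r (m - r); rewrite subnKC.
by ring.
Qed.

(** Inserting the factor P_L / P_(L-m) changes nothing modulo q^N: for m < N it is
congruent to 1, and for m >= N the term itself is divisible by q^(m^2). *)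
Lemma eqm_diagonals N L : (N.*2 <= L)%N ->
  eqm N ((\sum_(m < N) q ^+ (m ^ 2) * O m * (rogers_szego p m m / P m.*2)))
    (\sum_(m < L.+1)
       q ^+ (m ^ 2) * O m * (rogers_szego p m m / P m.*2) / P (L - m) * P L).
Proof.
move=> NL.
have -> : (L.+1 = N + (L.+1 - N))%N by lia.
rewrite big_split_ord /= -[X in eqm _ X _]addr0.
move=> k kN; rewrite !fps_coefD; congr (_ + _).
  move: k kN; apply: eqm_sum => m _.
  rewrite -[X in eqm _ X _]mulr1 -[X in eqm _ _ X]mulrA; apply: eqmM => //.
  rewrite -[X in eqm _ X _](mulVr (Pu (L - m))); apply: eqmM => //.
  by apply: eqm_qpoch => //; have := ltn_ord m; lia.
rewrite fps_coef_sum big1 // => m _.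
rewrite -!mulrA; apply: (@eqm_Xn _ N) => //; nia.
Qed.

Definition product_side := qpochs_inf [:: q ^+ 6; q ^+ 8; q ^+ 14] (q ^+ 14)
       * qpoch_inf (q ^+ 2) (q ^+ 4)
     / qpoch_inf q q.

(** The factor (q;q^2)_L is common to (q;q)_2L = (q;q^2)_L P_L and to
(q^2;q^4)_L = (q;q^2)_L O_L; cancelling it removes the quotient. *)
Lemma eqm_product_side N L : (N <= L)%N ->
  eqm N (product_side * P L)
    (qpoch (q ^+ 6) (q ^+ 14) L * qpoch (q ^+ 8) (q ^+ 14) L
       * qpoch (q ^+ 14) (q ^+ 14) L * O L).
Proof.
move=> NL; have x0 n : (0 < n)%N -> (q ^+ n) 0%N = 0 by exact: coef0_exp.
apply: (@eqm_cancel _ _ _ _ (qpoch q p L)); first exact: qpoch_unit.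
have PqE : P L * qpoch q p L = qpoch q q L.*2 by rewrite qpoch_split mulrC.
rewrite -[X in eqm _ X _]mulrA PqE.
apply: (@eqm_trans _ _ (product_side * qpoch_inf q q)).
  by apply: eqmM => //; apply: eqm_sym; apply: eqm_qpoch_inf => //; lia.
have -> : product_side * qpoch_inf q q =
    qpochs_inf [:: q ^+ 6; q ^+ 8; q ^+ 14] (q ^+ 14) * qpoch_inf (q ^+ 2) (q ^+ 4).
  by apply: mulrVK; apply: qpoch_inf_unit.
rewrite -[X in eqm _ _ X]mulrA; apply: eqmM.
  rewrite qpochs_inf3.
  by apply: eqmM; first apply: eqmM; apply: eqm_qpoch_inf => //; exact: x0.
have -> : O L * qpoch q p L = qpoch (q ^+ 2) (q ^+ 4) L.
  elim: (L) => [|m IHm]; first by rewrite /O !qpoch0 mulr1.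
  rewrite /O !qpochS -IHm /O.
  have -> : q ^+ 4 = p * p by rewrite /p; ring.
  by rewrite (exprMn m p p); ring.
by apply: eqm_qpoch_inf => //; exact: x0.
Qed.

Lemma diagonals_product_side N : eqm N
  (\sum_(m < N) \sum_(r < m.+1) F ((m - r)%N, nat_of_ord r)) product_side.
Proof.
pose L := (3 * N)%N.
apply: (@eqm_cancel _ _ _ _ (P L)) => //.
under eq_bigr => m _ do rewrite sum_diag.
apply: eqm_trans (eqm_sym (@eqm_product_side N L _)); last by lia.
have e1 := @eqm_diagonals N L ltac:(lia).
rewrite -mulr_suml (finite_bailey q0 (leqnn L)) in e1.
have t1 := @eqm_theta R N L 2 p p0 isT (leqnn _).
have t2 := @eqm_theta R N L 1 (q ^+ 14) (coef0_exp q0 (isT : 0 < 14)%N) isT (leqnn _).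
(* Replaces j * 1 by j under the bilateral sum. *)
rewrite (@eq_bisum _ L _ _ (fun j =>
  congr1 (fun x => _ * (_ * gaussz _ _ (_ + x))) (mulr1 j))) in t2.
rewrite finite_triple_product in t2.
have PP : eqm N (P L) (P L.*2) by apply: eqm_qpoch => //; lia.
exact: (eqm_assemble (Pu _) e1 t1 t2 PP).
Qed.

(** The finite sets of summation indices along which the unordered sum is
evaluated; they exhaust the pairs by diagonals n + r = m. *)
Definition diagonals N : seq (nat * nat) :=
  [seq ((m - r)%N, r) | m <- iota 0 N, r <- iota 0 m.+1].

Lemma mem_diagonals N n r : ((n, r) \in diagonals N) = (n + r < N)%N.
Proof.
apply/allpairsPdep/idP => [[m [s [mN sm [-> ->]]]]|nrN].
  by move: mN sm; rewrite !mem_iota; lia.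
exists (n + r)%N, r; rewrite addnK.
by split; rewrite ?mem_iota //= ?add0n ?ltnS ?leq_addl.
Qed.

Lemma uniq_diagonals N : uniq (diagonals N).
Proof.
apply: allpairs_uniq_dep => [|m _|]; try exact: iota_uniq.
move=> [m r] [m' r'] /allpairsPdep [m1 [r1 [_ + [-> ->]]]].
move=> + /allpairsPdep [m2 [r2 [_ + [-> ->]]]] /=.
rewrite !mem_iota => r2m r1m [mr rr].
by rewrite -rr in mr r2m *; have -> : m1 = m2 by lia.
Qed.

Lemma diag_small N n r : (N <= n + r)%N -> eqm N (F (n, r)) 0.
Proof. by move=> Nnr; rewrite /F -!mulrA; apply: eqm_Xn; nia. Qed.

(** A term with n + r > k has no coefficient of degree k, so every finite set that
contains the diagonals up to k gives the same coefficient. *)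
Lemma summand_has_sum : fps_has_sum F product_side.
Proof.
move=> k; exists [fset x in diagonals k.+1]%fset => J DJ.
rewrite -(@diagonals_product_side k.+1 k) // fps_coef_sum.
rewrite -(big_fset_incl _ DJ) => [|[n r] _]; last first.
  by rewrite in_fset mem_diagonals -leqNgt => /diag_small ->.
rewrite (perm_big (diagonals k.+1)) /=; last first.
  by apply: uniq_perm; rewrite ?fset_uniq ?uniq_diagonals // => x; rewrite in_fset.
have iotaE n : iota 0 n = index_iota 0 n by rewrite /index_iota subn0.
rewrite big_allpairs_dep iotaE big_mkord !fps_coef_sum; apply: eq_bigr => m _.
by rewrite iotaE big_mkord fps_coef_sum.
Qed.

End Main.

Theorem mainTheorem2 (R : comNzRingType) (q := fpsX : fps R) :
  fps_has_sum
    (fun nr : nat * nat => let: (n, r) := nr in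
       q ^+ (n ^ 2 + 3 * r ^ 2 + 4 * n * r)
         * qpoch (- q) (- q) (2 * n + 2 * r)
       / (qpoch (q ^+ 2) (q ^+ 2) (2 * n + 2 * r)
          * qpoch (q ^+ 2) (q ^+ 2) r * qpoch (q ^+ 2) (q ^+ 2) n))
    (qpochs_inf [:: q ^+ 6; q ^+ 8; q ^+ 14] (q ^+ 14)
       * qpoch_inf (q ^+ 2) (q ^+ 4)
     / qpoch_inf q q).
Proof. exact: summand_has_sum. Qed.
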